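(* Let $V_a$, $\{V_{a_i}\}_{i\in\mathbb{N}}$, $\{R_i\}_{i\in\mathbb{N}}$ be a space splitting as in the context, and assume that for some constant $\Lambda$ one has $\|R_iv_i\|_a\le \Lambda\|v_i\|_{a_i}$ for all $v_i\in V_{a_i}$, $i\in\mathbb{N}$. For any $e\in V_a$, denote $r_i=T_ie\in V_{a_i}$ and $w_i=\|r_i\|_{a_i}^{-1}R_ir_i\in V_a$ (with $w_i:=0$ if $r_i=0$), $i\in\mathbb{N}$. a) If $i^\ast\in\mathbb{N}$ is such that $\|r_{i^\ast}\|_{a_{i^\ast}}\ge\beta\sup_{i\in\mathbb{N}}\|r_i\|_{a_i}$ for some $0<\beta\le1$, then, for any nontrivial $h\in\mathcal{A}_1$, $$\|r_{i^\ast}\|_{a_{i^\ast}}=a(e,w_{i^\ast})\ge\frac{\beta}{\|h\|_{\mathcal{A}_1}}\,\mathrm{Re}\,a(e,h).$$ b) If $\pi=\{\pi_i\}_{i\in\mathbb{N}}$ is any discrete probability distribution, then, for any nontrivial $h\in\mathcal{A}^\pi_\infty$, $$\sum_{i\in\mathbb{N}}\pi_i\|r_i\|_{a_i}=\sum_{i\in\mathbb{N}}\pi_i\,a(e,w_i)\ge\frac{1}{\|h\|_{\mathcal{A}^\pi_\infty}}\,\mathrm{Re}\,a(e,h).$$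
   Context: **Setting.** $V$ is a separable real or complex Hilbert space, $a(\cdot,\cdot)$ is a continuous coercive Hermitian form on $V$, and $V_a$ denotes $V$ equipped with the (equivalent) scalar product $a$ and norm $\|v\|_a=a(v,v)^{1/2}$. For each $i\in\mathbb{N}$, $V_{a_i}$ is a Hilbert space with scalar product $a_i(\cdot,\cdot)$ and norm $\|\cdot\|_{a_i}$, and $R_i:V_{a_i}\to V_a$ is a bounded linear operator; $\mathrm{span}(\{R_iV_{a_i}\}_{i\in\mathbb{N}})$ is dense in $V_a$. Hermitian forms are linear in the first argument. (In the real case $\mathrm{Re}$ is redundant.) **Operators $T_i$.** $T_i:V_a\to V_{a_i}$ is defined by $a_i(T_iv,v_i)=a(v,R_iv_i)$ for all $v_i\in V_{a_i}$. **Approximation spaces.** A discrete probability distribution is a sequence $\pi=\{\pi_i\}_{i\in\mathbb{N}}$ with $\pi_i\ge0$, $\sum_i\pi_i=1$; $\mathrm{supp}(\pi)=\{i:\pi_i>0\}$. For a non-negative weight sequence $\gamma=\{\gamma_i\}_{i\in\mathbb{N}}$ and $0<q\le\infty$, define for $u\in\mathrm{span}(\{R_iV_{a_i}\}_{i\in\mathrm{supp}(\gamma)})$ $$\|u\|_{\mathcal{A}^\gamma_q}=\inf\left\{\big\|\{\gamma_i^{-1}\|v_i\|_{a_i}\}_{i\in I}\big\|_{\ell^q}:\ u=\sum_{i\in I}R_iv_i,\ v_i\in V_{a_i},\ I\subset\mathrm{supp}(\gamma)\text{ finite}\right\},$$ and let $\mathcal{A}^\gamma_q$ be the completion with respect to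 this (quasi-)norm. $\mathcal{A}_q$ denotes the case $\gamma_i=1$ for all $i$. For $\mathcal{A}_1$ and $\mathcal{A}_\infty^\pi$ one has $\|\cdot\|_a\le\Lambda\|\cdot\|_{\mathcal{A}}$ on finite sums, and elements of these completions are regarded as elements of $V_a$ via the continuous extension of the inclusion of the span into $V_a$. *)

(* Defs.v *)
From HB Require Import structures.
From mathcomp Require Import all_boot all_order all_algebra.
From mathcomp Require Import sesquilinear finmap.
From mathcomp Require Import all_classical all_reals all_analysis.
From mathcomp.real_closed Require Import complex.

Set Implicit Arguments.
Unset Strict Implicit.
Unset Printing Implicit Defensive.

Import Order.TTheory GRing.Theory Num.Theory.
Import numFieldNormedType.Exports.

Local Open Scope classical_set_scope.
Local Open Scope ring_scope.

Variant scalar_kind := RealScalars | ComplexScalars.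

Definition scalar_field (R : realType) (k : scalar_kind) : numFieldType :=
  match k with RealScalars => R | ComplexScalars => R[i] end.

Definition scalar_conj (R : realType) (k : scalar_kind) :
    {rmorphism scalar_field R k -> scalar_field R k} :=
  match k return {rmorphism scalar_field R k -> scalar_field R k} with
  | RealScalars => @idfun R
  | ComplexScalars => @Num.conj R[i]
  end.

Definition scalar_re (R : realType) (k : scalar_kind) : scalar_field R k -> R :=
  match k return scalar_field R k -> R with
  | RealScalars => @idfun R
  | ComplexScalars => @complex.Re R
  end.

Definition scalar_of_real (R : realType) (k : scalar_kind) : R -> scalar_field R k :=
  match k return R -> scalar_field R k with
  | RealScalars => @idfun R
  | ComplexScalars => @real_complex R
  end.

Arguments scalar_conj {R k}.
Arguments scalar_re {R k}.
Arguments scalar_of_real {R} k.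

Section HilbertSpaces.
Context {R : realType} {k : scalar_kind}.
Local Notation K := (scalar_field R k).

Definition form_norm {V : lmodType K} (f : V -> V -> K) (v : V) : R :=
  Num.sqrt (scalar_re (f v v)).

(* A completeNormedModType whose norm is induced by a {dot V for scalar_conj}
   is a Hilbert space. *)
Definition induces_norm {V : normedModType K} (f : V -> V -> K) :=
  forall v : V, `|v| ^+ 2 = f v v.

Definition separable_space (V : topologicalType) :=
  exists D : set V, countable D /\ dense D.

Definition continuous_form {V : normedModType K} (f : V -> V -> K) :=
  continuous (fun p : V * V => f p.1 p.2).

(* In R[i], [x <= y] means that y - x is real and nonnegative. *)
Definition coercive_form {V : normedModType K} (f : V -> V -> K) :=
  exists c : K, 0 < c /\ forall v : V, c * `|v| ^+ 2 <= f v v.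

Definition bounded_operator {U V : lmodType K} (fU : U -> U -> K)
    (fV : V -> V -> K) (A : U -> V) :=
  exists C : R, forall u : U, form_norm fV (A u) <= C * form_norm fU u.

Definition linear_span {V : lmodType K} (S : set V) : set V :=
  [set u | exists (n : nat) (c : 'I_n -> K) (s : 'I_n -> V),
     (forall j, S (s j)) /\ u = \sum_(j < n) c j *: s j].

End HilbertSpaces.

Definition weight_supp (R : realType) (gamma : nat -> R) : set nat :=
  [set i | 0 < gamma i].

Definition discrete_distribution (R : realType) (p : nat -> R) :=
  (forall i, 0 <= p i) /\ series p @ \oo --> (1 : R).

Section ApproximationSpaces.
Context {R : realType} {k : scalar_kind}.
Local Notation K := (scalar_field R k).
Context {V : completeNormedModType K} {W : nat -> completeNormedModType K}.
Variables (aW : forall i, {dot W i for (@scalar_conj R k)})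
  (Rop : forall i, {linear W i -> V}).
Variables (gamma : nat -> R) (q : \bar R).

Definition splitting_span (J : set nat) : set V :=
  linear_span (\bigcup_(i in J) range (Rop i)).

(* The finite family indexed by I is extended by zero to nat, so its l^q norm
   is its L^q norm for the counting measure. *)
Definition approx_norm (u : V) : \bar R :=
  ereal_inf [set s | exists (I : {fset nat}) (v : forall i, W i),
    [/\ [set` I] `<=` weight_supp gamma,
        u = \sum_(i <- I) Rop i (v i) &
        s = Lnorm counting q
          (EFin \o ((fun i => (gamma i)^-1 * form_norm (aW i) (v i))
                      \_ [set` I]))]].

Definition approx_cauchy (u : nat -> V) :=
  (forall n, splitting_span (weight_supp gamma) (u n)) /\
  forall eps : R, 0 < eps -> exists N, forall m n, (N <= m)%N -> (N <= n)%N ->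
    (approx_norm (u m - u n)%R < eps%:E)%E.

Definition cauchy_class (u : nat -> V) : set (nat -> V) :=
  [set v | approx_cauchy v /\ approx_norm (u n - v n) @[n --> \oo] --> 0%E].

(* The completion of the span: Cauchy sequences modulo null sequences. *)
Record approx_space := ApproxSpace {
  approx_class :> set (nat -> V);
  approx_classP : exists u, approx_cauchy u /\ approx_class = cauchy_class u
}.

(* Any representative: the two limits below are the same for all of them when
   approx_norm is a norm dominating the norm of V, as for q = 1 and for a
   probability weight with q = +oo. *)
Definition approx_repr (h : approx_space) : nat -> V :=
  projT1 (cid (approx_classP h)).

Definition approx_nontrivial (h : approx_space) :=
  approx_class h <> cauchy_class (fun=> 0).

Definition completed_norm (h : approx_space) : R :=
  fine (limn (fun n => approx_norm (approx_repr h n))).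

(* Continuous extension to the completion of the inclusion of the span into V;
   it need not be injective. *)
Definition approx_val (h : approx_space) : V := limn (approx_repr h).

End ApproximationSpaces.

(* Main.v *)
Require Import Defs.
From HB Require Import structures.
From mathcomp Require Import all_boot all_order all_algebra.
From mathcomp Require Import sesquilinear finmap.
From mathcomp Require Import all_classical all_reals all_analysis.
From mathcomp.real_closed Require Import complex.
From mathcomp Require Import ess_sup_inf lra.

Set Implicit Arguments.
Unset Strict Implicit.
Unset Printing Implicit Defensive.

Import Order.TTheory GRing.Theory Num.Theory.
Import numFieldNormedType.Exports.

Local Open Scope classical_set_scope.
Local Open Scope ring_scope.

(* By Cauchy-Schwarz in each [W i], a representation [u = \sum_(i in I) R_i v_i]
   gives [Re a(e, u) = \sum Re a_i(r_i, v_i) <= \sum |r_i| |v_i|], which is at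
   most [(sup_i |r_i|) * \sum |v_i|] and at most
   [(\sum p_i |r_i|) * max_i p_i^-1 |v_i|]. Taking the infimum over
   representations bounds [Re a(e, u)] by a multiple of the approximation norm
   of u, for every e; the choice [e := u] shows that this norm dominates
   [|.|_a], so that Cauchy representatives converge in V and both inequalities
   pass to the completion. *)

Section Scalars.
Variables (R : realType) (k : scalar_kind).
Local Notation K := (scalar_field R k).
Implicit Types (x y : K) (r s : R).

Lemma scalar_re_is_additive : zmod_morphism (@scalar_re R k).
Proof. by case: k => // -[x1 x2] [y1 y2]. Qed.

Lemma scalar_of_real_is_additive : zmod_morphism (@scalar_of_real R k).
Proof. by case: k => // r s; rewrite /= rmorphB. Qed.

Lemma scalar_of_real_is_multiplicative : monoid_morphism (@scalar_of_real R k).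
Proof. by case: k; split=> // r s; rewrite /= rmorphM. Qed.

HB.instance Definition _ := GRing.isZmodMorphism.Build K R (@scalar_re R k)
  scalar_re_is_additive.
HB.instance Definition _ := GRing.isZmodMorphism.Build R K (@scalar_of_real R k)
  scalar_of_real_is_additive.
HB.instance Definition _ := GRing.isMonoidMorphism.Build R K (@scalar_of_real R k)
  scalar_of_real_is_multiplicative.

Lemma scalar_of_realK : cancel (@scalar_of_real R k) scalar_re.
Proof. by case: k. Qed.

Lemma scalar_re_realM r x : scalar_re (scalar_of_real k r * x) = r * scalar_re x.
Proof. by case: k x => //= -[x1 x2] /=; rewrite mul0r subr0. Qed.

Lemma scalar_re_conj x : scalar_re (scalar_conj x) = scalar_re x.
Proof. by case: k x => //= -[]. Qed.

Lemma scalar_conj_real r : scalar_conj (scalar_of_real k r) = scalar_of_real k r.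
Proof. by case: k => //=; exact: conjc_real. Qed.

Lemma ltr_scalar_of_real : {mono @scalar_of_real R k : r s / r < s}.
Proof. by case: k => // r s; exact: ltcR. Qed.

Lemma ler_scalar_re x y : x <= y -> scalar_re x <= scalar_re y.
Proof. by case: k x y => //= x y; rewrite lecE => /andP[]. Qed.

Lemma normr_scalar_re x : scalar_of_real k `|scalar_re x| <= `|x|.
Proof. by case: k x => // x; exact: normc_ge_Re. Qed.

Lemma normr_scalar_of_real r : `|scalar_of_real k r| = scalar_of_real k `|r|.
Proof. by case: k => //=; rewrite normc_def expr0n addr0 sqrtr_sqr. Qed.

Lemma ger0_scalarE x : 0 <= x -> x = scalar_of_real k (scalar_re x).
Proof.
case: k x => //= -[x1 x2]; rewrite lecE /= => /andP[/eqP->].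
by [].
Qed.

Lemma cvg_scalar_of_real (T : Type) (F : set_system T) (f : T -> R) r :
  Filter F -> f x @[x --> F] --> r ->
  scalar_of_real k (f x) @[x --> F] --> scalar_of_real k r.
Proof.
move=> FF fr; apply/cvgrPdist_lt => eps eps0.
have epsE := ger0_scalarE (ltW eps0).
move: eps0; rewrite epsE -[0](rmorph0 (@scalar_of_real R k)) ltr_scalar_of_real.
move=> eps0; move/cvgrPdist_lt : fr => /(_ _ eps0); apply: filterS => t.
by rewrite -rmorphB normr_scalar_of_real ltr_scalar_of_real.
Qed.

Lemma cvg_scalar_re (T : Type) (F : set_system T) (f : T -> K) x :
  Filter F -> f t @[t --> F] --> x ->
  scalar_re (f t) @[t --> F] --> scalar_re x.
Proof.
move=> FF fx; apply/cvgrPdist_lt => eps eps0.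
have eps0' : 0 < scalar_of_real k eps.
  by rewrite -[0](rmorph0 (@scalar_of_real R k)) ltr_scalar_of_real.
move/cvgrPdist_lt : fx => /(_ _ eps0'); apply: filterS => t.
rewrite -raddfB => /(le_lt_trans (normr_scalar_re _)).
by rewrite ltr_scalar_of_real.
Qed.

End Scalars.

Section PositiveForms.
Variables (R : realType) (k : scalar_kind).
Local Notation K := (scalar_field R k).
Variables (U : lmodType K) (f : {hermitian U for false & @scalar_conj R k}).
Hypothesis f_pos : forall u, u != 0 -> 0 < f u u.

Lemma form_self_ge0 u : 0 <= f u u.
Proof. by have [->|/f_pos/ltW//] := eqVneq u 0; rewrite linear0l. Qed.

Lemma form_norm_ge0 (V : lmodType K) (g : V -> V -> K) v : 0 <= form_norm g v.
Proof. exact: sqrtr_ge0. Qed.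

Lemma sqr_form_norm u : form_norm f u ^+ 2 = scalar_re (f u u).
Proof.
rewrite sqr_sqrtr//; have := ler_scalar_re (form_self_ge0 u).
by rewrite raddf0.
Qed.

Lemma form_selfE u : f u u = scalar_of_real k (form_norm f u ^+ 2).
Proof. by rewrite sqr_form_norm -ger0_scalarE// form_self_ge0. Qed.

Lemma form_norm0 : form_norm f 0 = 0.
Proof. by rewrite /form_norm linear0l raddf0 sqrtr0. Qed.

Lemma form_norm_eq0 u : form_norm f u = 0 -> u = 0.
Proof.
move=> u0; apply/eqP; apply: contraT => /f_pos.
by rewrite form_selfE u0 expr0n rmorph0 ltxx.
Qed.

Lemma sqr_form_normB u v : form_norm f (u - v) ^+ 2 =
  form_norm f u ^+ 2 + form_norm f v ^+ 2 - scalar_re (f u v) *+ 2.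
Proof.
rewrite !sqr_form_norm hnormB /= mul1r raddfB !raddfD /=.
by rewrite scalar_re_conj -mulr2n.
Qed.

Lemma form_norm_realZ r u :
  form_norm f (scalar_of_real k r *: u) = `|r| * form_norm f u.
Proof.
rewrite /form_norm linearZl_LR linearZr_LR /= scalar_conj_real !scalar_re_realM.
by rewrite mulrA -expr2 sqrtrM ?sqr_ge0// sqrtr_sqr.
Qed.

(* Expand the nonnegative square of [|v| u - |u| v]. *)
Lemma re_form_le u v : scalar_re (f u v) <= form_norm f u * form_norm f v.
Proof.
have [/form_norm_eq0->|u0] := eqVneq (form_norm f u) 0.
  by rewrite linear0l raddf0 form_norm0 mul0r.
have [/form_norm_eq0->|v0] := eqVneq (form_norm f v) 0.
  by rewrite linear0r raddf0 form_norm0 mulr0.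
set s := form_norm f u; set t := form_norm f v.
have s0 : 0 < s by rewrite lt_def u0 form_norm_ge0.
have t0 : 0 < t by rewrite lt_def v0 form_norm_ge0.
have : 0 <= form_norm f (scalar_of_real k t *: u - scalar_of_real k s *: v) ^+ 2.
  exact: sqr_ge0.
rewrite sqr_form_normB !form_norm_realZ linearZl_LR linearZr_LR /=.
rewrite scalar_conj_real !scalar_re_realM -/s -/t !gtr0_norm//.
move=> h; rewrite -(ler_pM2l (mulr_gt0 s0 t0)); nra.
Qed.

Lemma ler_form_normD u v : form_norm f (u + v) <= form_norm f u + form_norm f v.
Proof.
rewrite -(@ler_pXn2r _ 2) ?nnegrE ?addr_ge0 ?form_norm_ge0//.
rewrite -[u + v]/(u + v) -{1}[v]opprK sqr_form_normB linearNr raddfN /=.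
have := re_form_le u v.
have -> : form_norm f (- v) = form_norm f v by rewrite /form_norm hnormN.
nra.
Qed.

End PositiveForms.

Section CountingNorms.
Variable R : realType.
Implicit Types (f g : nat -> R) (I : {fset nat}) (q : \bar R).

Lemma ae_counting (P : set nat) :
  (\forall n \ae (@counting nat R), P n) -> forall n, P n.
Proof.
move=> [N [_ N0 PN]] n; apply: contrapT => nP; have /= Nn := PN _ nP.
move: N0; rewrite /counting; case: asboolP => // finN [] /eqP.
rewrite pnatr_eq0 cardfs_eq0 => /eqP/(fset_set_set0 finN) N0.
by rewrite N0 in Nn.
Qed.

Lemma counting_setT_gt0 : (0 < @counting nat R [set: nat])%E.
Proof. by rewrite /counting asboolF//; exact: infinite_nat. Qed.

Lemma le_Lnorm_counting q f g : (0 < q)%E -> (forall n, `|f n| <= `|g n|) ->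
  (Lnorm counting q (EFin \o f) <= Lnorm counting q (EFin \o g))%E.
Proof.
move=> q0 fg; rewrite unlock; case: q q0 => [r|_|//].
- rewrite lte_fin /= => r0.
  have int_ge0 (h : nat -> R) : (0 <= \int[counting]_n (`|h n| `^ r)%:E)%E.
    by apply: integral_ge0 => n _; rewrite lee_fin powR_ge0.
  rewrite gt0_ler_poweR ?invr_ge0 ?(ltW r0) ?in_itv/= ?int_ge0 ?leey//.
  apply: ge0_le_integral => //= n _; rewrite lee_fin ?powR_ge0//.
  by rewrite ge0_ler_powR ?(ltW r0) ?nnegrE.
- rewrite counting_setT_gt0; apply: le_ess_sup; apply: nearW => n /=.
  by rewrite lee_fin.
Qed.

Lemma Lnorm_counting_fset_lty q f I : (0 < q)%E ->
  (Lnorm counting q (EFin \o (f \_ [set` I])) < +oo)%E.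
Proof.
move=> q0; pose c := \sum_(i <- I) `|f i|.
have fc i : i \in I -> `|f i| <= c.
  move=> iI; rewrite /c (big_fsetD1 i)//= lerDl; exact: sumr_ge0.
have c0 : 0 <= c by exact: sumr_ge0.
rewrite unlock; case: q q0 => [r|_|//].
- rewrite lte_fin /= => r0.
  apply: poweR_lty.
  apply: (@le_lt_trans _ _ (\int[counting]_(n in [set` I]) (cst (c `^ r)%:E n))%E).
    rewrite [leRHS]integral_mkcond; apply: ge0_le_integral => //.
    move=> n _; rewrite !patchE.
    case: ifPn => [/set_mem/fc fn|_].
      by rewrite lee_fin ge0_ler_powR ?(ltW r0) ?nnegrE.
    by rewrite normr0 powR0// gt_eqF.
  rewrite integral_cst//= /counting asboolT; last exact: finite_fset.
  by rewrite -EFinM ltry.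
- rewrite counting_setT_gt0; apply: (@le_lt_trans _ _ c%:E); last exact: ltry.
  apply/ess_supP; apply: nearW => n /=; rewrite lee_fin patchE.
  by case: ifPn => [/set_mem/fc//|_]; rewrite normr0.
Qed.

Lemma fset_sum_le (g : nat -> R) I : (forall i, 0 <= g i) ->
  exists n, \sum_(i <- I) g i <= \sum_(0 <= i < n) g i.
Proof.
move=> g0; exists (\max_(i <- I) i).+1.
have eqI : perm_eq I [seq i <- index_iota 0 (\max_(i <- I) i).+1 | i \in I].
  apply: uniq_perm; rewrite ?filter_uniq ?iota_uniq ?fset_uniq// => i.
  rewrite mem_filter mem_index_iota /= ltnS.
  case: (boolP (i \in I)) => //= iI.
  apply: esym; exact: leq_bigmax_seq iI isT.
by rewrite (perm_big _ eqI) big_filter [leRHS](bigID (mem I)) /= lerDl sumr_ge0.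
Qed.

Lemma fset_sum_le_Lnorm1 f I : (forall i, 0 <= f i) ->
  ((\sum_(i <- I) f i)%:E <= Lnorm counting 1 (EFin \o (f \_ [set` I])))%E.
Proof.
move=> f0; set g := f \_ [set` I].
have g0 i : 0 <= g i by rewrite /g patchE; case: ifP.
have -> : \sum_(i <- I) f i = \sum_(i <- I) g i.
  by apply: eq_big_seq => i iI; rewrite /g patchE mem_set.
have [n /le_trans] := fset_sum_le I g0.
rewrite Lnorm1 ge0_integral_count// => le_sum.
apply: le_trans (nneseries_lim_ge n _) => //.
rewrite /= (eq_bigr (EFin \o g)) => [|i _]; last by rewrite /= ger0_norm.
by rewrite sumEFin lee_fin le_sum.
Qed.

Lemma le_Lnorm_infty f I i : i \in I ->
  (`|f i|%:E <= Lnorm counting +oo (EFin \o (f \_ [set` I])))%E.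
Proof.
move=> iI; rewrite unlock counting_setT_gt0.
have := ae_counting (ess_sup_ge counting (abse \o (EFin \o (f \_ [set` I])))) i.
by rewrite /= patchE mem_set.
Qed.

End CountingNorms.

Section ApproxNorm.
Context {R : realType} {k : scalar_kind}.
Local Notation K := (scalar_field R k).
Context {V : completeNormedModType K} {W : nat -> completeNormedModType K}.
Variables (aW : forall i, {dot W i for (@scalar_conj R k)})
  (Rop : forall i, {linear W i -> V}).
Variables (gamma : nat -> R) (q : \bar R).
Hypothesis q_ge1 : (1 <= q)%E.

Local Notation N := (approx_norm aW Rop gamma q).
Local Notation weight v := (fun i => (gamma i)^-1 * form_norm (aW i) (v i)).
Local Notation rep_norm I v := (Lnorm counting q (EFin \o (weight v \_ [set` I]))).

Let q_gt0 : (0 < q)%E.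
Proof. exact: lt_le_trans q_ge1. Qed.

Lemma approx_norm_le (I : {fset nat}) (v : forall i, W i) :
  [set` I] `<=` weight_supp gamma ->
  (N (\sum_(i <- I) Rop i (v i))%R <= rep_norm I v)%E.
Proof. by move=> Ig; apply: ereal_inf_lbound; exists I, v. Qed.

Lemma approx_norm_ge0 u : (0 <= N u)%E.
Proof. by apply: le_ereal_inf_tmp => _ [I [v [_ _ ->]]]; exact: Lnorm_ge0. Qed.

Lemma approx_norm_adherent u (eps : R) : 0 < eps -> N u \is a fin_num ->
  exists (I : {fset nat}) (v : forall i, W i),
    [/\ [set` I] `<=` weight_supp gamma, u = \sum_(i <- I) Rop i (v i) &
        (rep_norm I v < N u + eps%:E)%E].
Proof.
move=> eps0 /(lb_ereal_inf_adherent eps0)[_ [I [v [Ig uE ->]]] ltN].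
by exists I, v.
Qed.

Lemma approx_normD u v : (N (u + v)%R <= N u + N v)%E.
Proof.
have [Nu|] := boolP (N u \is a fin_num); last first.
  by rewrite ge0_fin_numE ?approx_norm_ge0// -leNgt leye_eq => /eqP->;
    rewrite addye ?leey// gt_eqF// (lt_le_trans _ (approx_norm_ge0 v)).
have [Nv|] := boolP (N v \is a fin_num); last first.
  by rewrite ge0_fin_numE ?approx_norm_ge0// -leNgt leye_eq => /eqP->;
    rewrite addey ?leey// gt_eqF// (lt_le_trans _ (approx_norm_ge0 u)).
apply/lee_addgt0Pr => eps eps0; have eps2 : 0 < eps / 2 by rewrite divr_gt0.
have [I [x [Ig uE xN]]] := approx_norm_adherent eps2 Nu.
have [J [y [Jg vE yN]]] := approx_norm_adherent eps2 Nv.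
pose x' i := if i \in I then x i else 0; pose y' i := if i \in J then y i else 0.
have extend (A B : {fset nat}) (z z' : forall i, W i) :
    (A `<=` B)%fset -> (forall i, z' i = if i \in A then z i else 0) ->
    \sum_(i <- A) Rop i (z i) = \sum_(i <- B) Rop i (z' i).
  move=> AB z'E; rewrite -(big_fset_incl _ AB) => [|i _ /negPf iA].
    by apply: eq_big_seq => i iA; rewrite z'E iA.
  by rewrite z'E iA linear0.
have uvE : u + v = \sum_(i <- (I `|` J)%fset) Rop i (x' i + y' i).
  under eq_bigr do rewrite linearD.
  rewrite big_split /= uE vE (extend I (I `|` J)%fset x x') ?fsubsetUl//.
  by rewrite (extend J (I `|` J)%fset y y') ?fsubsetUr.
have IJg : [set` (I `|` J)%fset] `<=` weight_supp gamma.
  by move=> i /=; rewrite inE => /orP[/Ig|/Jg].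
rewrite uvE; apply: (le_trans (approx_norm_le (fun i => x' i + y' i) IJg)).
apply: (@le_trans _ _ (rep_norm I x + rep_norm J y)%E); last first.
  by rewrite [eps]splitr EFinD addeACA; apply: leeD; exact: ltW.
apply: le_trans; last exact: eminkowski.
have weightE (A : {fset nat}) (z z' : forall i, W i) i :
    (forall i, z' i = if i \in A then z i else 0) ->
    (weight z \_ [set` A]) i = weight z' i.
  move=> /(_ i) ->; rewrite patchE mem_setE.
  by case: ifP => // _; rewrite form_norm0 mulr0.
apply: le_Lnorm_counting => // i /=.
rewrite (weightE I x x')// (weightE J y y')// patchE mem_setE.
case: ifPn => [iIJ|_]; last by rewrite normr0.
have gi : 0 < (gamma i)^-1 by rewrite invr_gt0; exact: IJg.
rewrite -mulrDr !normrM ler_wpM2l// !ger0_norm ?addr_ge0 ?form_norm_ge0//.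
by apply: ler_form_normD => w; exact: neq0_dnorm_gt0.
Qed.

Lemma approx_norm_span_fin_num u :
  splitting_span Rop (weight_supp gamma) u -> N u \is a fin_num.
Proof.
move=> [n [c [s [sR ->]]]].
have N0 : (N 0%R < +oo)%E.
  have := @approx_norm_le fset0 (fun=> 0); rewrite big_seq_fset0.
  move=> /(_ _)/le_lt_trans; apply; first by move=> i; rewrite /= inE.
  exact: Lnorm_counting_fset_lty.
rewrite ge0_fin_numE ?approx_norm_ge0//.
elim/big_ind : _ => // [x y Nx Ny|j _].
  exact: le_lt_trans (approx_normD _ _) (lte_add_pinfty Nx Ny).
have [i gi [w _ <-]] := sR j; rewrite -linearZ.
pose v : forall l, W l := dfwith (fun l => 0 : W l) i (c j *: w).
have -> : Rop i (c j *: w) = \sum_(l <- [fset i]%fset) Rop l (v l).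
  by rewrite big_seq_fset1 /v dfwithin.
apply: le_lt_trans (Lnorm_counting_fset_lty _ _ q_gt0).
by apply: approx_norm_le => l /=; rewrite inE => /eqP->.
Qed.

Lemma approx_cauchy_fin_num u n : approx_cauchy aW Rop gamma q u ->
  N (u n) \is a fin_num.
Proof. by move=> [uspan _]; exact: approx_norm_span_fin_num. Qed.

Lemma approx_cauchy_norm_cvg u : approx_cauchy aW Rop gamma q u ->
  cvgn (fine \o (N \o u)).
Proof.
move=> uC; have [_ uC'] := uC; apply/cauchy_cvgP/cauchy_exP => eps eps0.
have [M uM] := uC' eps eps0; exists (fine (N (u M))); exists M => // n /= Mn.
have dist m l : (M <= m)%N -> (M <= l)%N ->
    fine (N (u m)) < fine (N (u l)) + eps.
  move=> Mm Ml; rewrite -lte_fin EFinD !fineK ?approx_cauchy_fin_num//.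
  rewrite -[u m](subrK (u l)); apply: (le_lt_trans (approx_normD _ _)).
  by rewrite addeC lte_leD ?approx_cauchy_fin_num// uM.
rewrite /ball /= ltr_norml.
have := dist n M Mn (leqnn M); have := dist M n (leqnn M) Mn; lra.
Qed.

Lemma approx_repr_cauchy (h : approx_space aW Rop gamma q) :
  approx_cauchy aW Rop gamma q (approx_repr h).
Proof. by rewrite /approx_repr; case: cid => u []. Qed.

Lemma cvg_approx_repr_norm (h : approx_space aW Rop gamma q) :
  fine (N (approx_repr h n)) @[n --> \oo] --> completed_norm h.
Proof.
have hC := approx_repr_cauchy h; have /cvg_ex[/= l hl] := approx_cauchy_norm_cvg hC.
rewrite /completed_norm; suff -> : limn (fun n => N (approx_repr h n)) = l%:E by [].
apply: cvg_lim => //; apply/fine_cvgP; split=> //.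
by apply: nearW => n; exact: approx_cauchy_fin_num.
Qed.

Lemma completed_norm_ge0 (h : approx_space aW Rop gamma q) : 0 <= completed_norm h.
Proof.
apply: (cvgr_to_ge (@cvg_approx_repr_norm h)).
by apply: nearW => n; rewrite fine_ge0// approx_norm_ge0.
Qed.

Lemma approx_norm_bound (phi : V -> R) (S : R) : 0 <= S ->
  (forall (I : {fset nat}) (v : forall i, W i), [set` I] `<=` weight_supp gamma ->
    ((phi (\sum_(i <- I) Rop i (v i)))%:E <= S%:E * rep_norm I v)%E) ->
  forall u, N u \is a fin_num -> phi u <= S * fine (N u).
Proof.
move=> S0 phiS u Nu; apply/ler_addgt0Pr => eps eps0.
have S1 : 0 < S + 1 by rewrite ltr_wpDl.
have [I [v [Ig uE vN]]] := approx_norm_adherent (divr_gt0 eps0 S1) Nu.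
rewrite -lee_fin uE; apply: (le_trans (phiS _ _ Ig)); rewrite -uE.
apply: (@le_trans _ _ (S%:E * (N u + (eps / (S + 1))%:E))%E).
  by rewrite lee_wpmul2l ?lee_fin// ltW.
rewrite -{1}(fineK Nu) -EFinD -EFinM lee_fin mulrDr lerD2l mulrCA.
by rewrite ger_pMr// ler_pdivrMr// mul1r lerDl.
Qed.

End ApproxNorm.

Section Duality.
Context {R : realType} {k : scalar_kind}.
Local Notation K := (scalar_field R k).
Context {V : completeNormedModType K} {W : nat -> completeNormedModType K}.
Variables (a : {hermitian V for false & @scalar_conj R k})
  (aW : forall i, {dot W i for (@scalar_conj R k)})
  (Rop : forall i, {linear W i -> V}) (T : forall i, V -> W i).
Hypotheses (a_coercive : coercive_form a)
  (a_continuous : continuous_form a)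
  (TE : forall i (v : V) (vi : W i), aW i (T i v) vi = a v (Rop i vi)).

Local Notation rnorm e i := (form_norm (aW i) (T i e)).

Lemma coercive_form_gt0 u : u != 0 -> 0 < a u u.
Proof.
have [c [c0 ca]] := a_coercive.
by move=> u0; apply: lt_le_trans (ca u); rewrite mulr_gt0 ?exprn_gt0 ?normr_gt0.
Qed.

Lemma dot_gt0 i (w : W i) : w != 0 -> 0 < aW i w w.
Proof. exact: neq0_dnorm_gt0. Qed.

Lemma re_form_sum_le e (I : {fset nat}) (v : forall i, W i) :
  scalar_re (a e (\sum_(i <- I) Rop i (v i))) <=
  \sum_(i <- I) rnorm e i * form_norm (aW i) (v i).
Proof.
rewrite linear_sumr raddf_sum; apply: ler_sum => i _.
by rewrite /= -TE; exact/re_form_le/dot_gt0.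
Qed.

Lemma form_residual e i : a e (Rop i (T i e)) = scalar_of_real k (rnorm e i ^+ 2).
Proof. by rewrite -TE; exact/form_selfE/dot_gt0. Qed.

Lemma form_direction e i :
  a e (if T i e == 0 then 0 else scalar_of_real k (rnorm e i)^-1 *: Rop i (T i e))
  = scalar_of_real k (rnorm e i).
Proof.
case: ifPn => [/eqP ->|r0]; first by rewrite linear0r form_norm0 rmorph0.
rewrite linearZr_LR /= scalar_conj_real form_residual -rmorphM /=.
rewrite expr2 mulKf//; apply: contra_neq r0.
by apply: form_norm_eq0; exact: dot_gt0.
Qed.

Lemma residual_norm_le (Lambda : R) e i :
  (forall w, form_norm a (Rop i w) <= Lambda * form_norm (aW i) w) ->
  rnorm e i <= `|Lambda| * form_norm a e.
Proof.
move=> RL; have := form_norm_ge0 (aW i) (T i e).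
rewrite le_eqVlt => /predU1P[<-|r0]; first by rewrite mulr_ge0 ?form_norm_ge0.
rewrite -(ler_pM2r r0) -expr2 -[leLHS](@scalar_of_realK R k) -form_residual.
apply: (le_trans (re_form_le coercive_form_gt0 _ _)).
rewrite mulrAC [leRHS]mulrC ler_wpM2l ?form_norm_ge0//.
by apply: (le_trans (RL _)); rewrite ler_wpM2r ?form_norm_ge0// ler_norm.
Qed.

Section Completion.
Variables (gamma : nat -> R) (q : \bar R).
Hypothesis q_ge1 : (1 <= q)%E.
Local Notation N := (approx_norm aW Rop gamma q).

Lemma cvg_approx_repr (M : R) (h : approx_space aW Rop gamma q) : 0 <= M ->
  (forall u, N u \is a fin_num -> form_norm a u <= M * fine (N u)) ->
  approx_repr h @ \oo --> approx_val h.
Proof.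
move=> M0 aM; suff : cvgn (approx_repr h) by [].
have [c [c0 ca]] := a_coercive.
apply/cauchy_cvgP/cauchy_exP => eps eps0.
pose r := scalar_re eps; pose d := scalar_re c.
have rE : eps = scalar_of_real k r by exact/ger0_scalarE/ltW.
have dE : c = scalar_of_real k d by exact/ger0_scalarE/ltW.
have r0 : 0 < r by rewrite -(ltr_scalar_of_real k) -rE rmorph0.
have d0 : 0 < d by rewrite -(ltr_scalar_of_real k) -dE rmorph0.
have M1 : 0 < M + 1 by rewrite ltr_wpDl.
pose delta := Num.sqrt d * r / (M + 1).
have delta0 : 0 < delta by rewrite divr_gt0// mulr_gt0 ?sqrtr_gt0.
have [_ /(_ _ delta0)[m hm]] := approx_repr_cauchy h.
exists (approx_repr h m); exists m => // n /= mn.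
rewrite -ball_normE /=; set u := _ - _.
have uN : (N u < delta%:E)%E by exact: hm.
have uN' : N u \is a fin_num.
  by rewrite ge0_fin_numE ?approx_norm_ge0// (lt_trans uN)// ltry.
have au : form_norm a u < Num.sqrt d * r.
  apply: (le_lt_trans (aM _ uN')).
  apply: (@le_lt_trans _ _ ((M + 1) * fine (N u))).
    by rewrite ler_wpM2r ?fine_ge0 ?approx_norm_ge0// lerDl.
  by rewrite mulrC -ltr_pdivlMr// -lte_fin fineK.
have : form_norm a u ^+ 2 < (Num.sqrt d * r) ^+ 2.
  by rewrite ltr_pXn2r// nnegrE ?form_norm_ge0 ?mulr_ge0 ?sqrtr_ge0 ?(ltW r0).
rewrite exprMn [Num.sqrt d ^+ 2]sqr_sqrtr ?(ltW d0)//.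
rewrite -(ltr_scalar_of_real k).
rewrite -form_selfE//; last exact: coercive_form_gt0.
move=> /(le_lt_trans (ca u)); rewrite dE rmorphM rmorphXn /= -rE.
rewrite ltr_pM2l; last by rewrite -dE.
by rewrite ltr_pXn2r// ?nnegrE// ltW.
Qed.

Lemma re_form_approx_val_le (M S : R) e (h : approx_space aW Rop gamma q) :
  0 <= M ->
  (forall u, N u \is a fin_num -> form_norm a u <= M * fine (N u)) ->
  (forall u, N u \is a fin_num -> scalar_re (a e u) <= S * fine (N u)) ->
  scalar_re (a e (approx_val h)) <= S * completed_norm h.
Proof.
move=> M0 aM aS; have hV := @cvg_approx_repr M h M0 aM.
have hN : S * fine (N (approx_repr h n)) @[n --> \oo] --> S * completed_norm h.
  by apply: cvgMr; exact: cvg_approx_repr_norm.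
have ha : scalar_re (a e (approx_repr h n)) @[n --> \oo] -->
    scalar_re (a e (approx_val h)).
  apply: cvg_scalar_re.
  have ae := @a_continuous (e, approx_val h).
  apply: (cvg_comp (fun n => (e, approx_repr h n)) (fun p => a p.1 p.2) _ ae).
  by apply: cvg_pair => //; exact: cvg_cst.
apply: (ler_cvg_to ha hN); apply: nearW => n.
by apply: aS; apply: approx_cauchy_fin_num => //; exact: approx_repr_cauchy.
Qed.

End Completion.

Lemma re_form_approx1_le (S : R) e : (forall i, rnorm e i <= S) ->
  forall u, approx_norm aW Rop (fun=> 1) 1 u \is a fin_num ->
  scalar_re (a e u) <= S * fine (approx_norm aW Rop (fun=> 1) 1 u).
Proof.
move=> rS; have S0 : 0 <= S := le_trans (form_norm_ge0 _ _) (rS 0%N).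
apply: approx_norm_bound => // I v _.
apply: (@le_trans _ _ (S%:E * (\sum_(i <- I) 1^-1 * form_norm (aW i) (v i))%:E)%E).
  rewrite -EFinM lee_fin; apply: (le_trans (re_form_sum_le _ _ _)).
  rewrite mulr_sumr; apply: ler_sum => i _.
  by rewrite invr1 mul1r ler_wpM2r ?form_norm_ge0.
rewrite lee_wpmul2l ?lee_fin//; apply: fset_sum_le_Lnorm1 => i.
by rewrite invr1 mul1r form_norm_ge0.
Qed.

Lemma re_form_approx_infty_le (p : nat -> R) (S : R) e :
  (forall n, \sum_(0 <= i < n) p i * rnorm e i <= S) -> (forall i, 0 <= p i) ->
  forall u, approx_norm aW Rop p +oo u \is a fin_num ->
  scalar_re (a e u) <= S * fine (approx_norm aW Rop p +oo u).
Proof.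
move=> pS p0; have S0 : 0 <= S by rewrite (le_trans _ (pS 0%N))// big_geq.
have pr0 i : 0 <= p i * rnorm e i by rewrite mulr_ge0 ?form_norm_ge0.
apply: approx_norm_bound => // I v Ip.
set L := Lnorm _ _ _; have L0 : (0 <= L)%E by exact: Lnorm_ge0.
have Lfin : L \is a fin_num by rewrite ge0_fin_numE// Lnorm_counting_fset_lty.
rewrite -(fineK Lfin) -EFinM lee_fin; apply: (le_trans (re_form_sum_le _ _ _)).
apply: (@le_trans _ _ (\sum_(i <- I) p i * rnorm e i * fine L)).
  rewrite big_seq [leRHS]big_seq; apply: ler_sum => i iI.
  have pi0 : 0 < p i := Ip _ iI.
  have : (((p i)^-1 * form_norm (aW i) (v i))%:E <= L)%E.
    have := le_Lnorm_infty (fun i => (p i)^-1 * form_norm (aW i) (v i)) iI.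
    by rewrite ger0_norm// mulr_ge0 ?invr_ge0 ?form_norm_ge0.
  rewrite -(fineK Lfin) lee_fin => vL.
  rewrite -[form_norm _ (v i)](mulVKf (lt0r_neq0 pi0)) mulrCA -mulrA.
  by rewrite ler_wpM2l// ler_wpM2l// form_norm_ge0.
rewrite -mulr_suml ler_wpM2r ?fine_ge0//.
by have [n /le_trans] := fset_sum_le I pr0; apply.
Qed.

End Duality.

Theorem lemma1 (R : realType) (k : scalar_kind)
  (V : completeNormedModType (scalar_field R k))
  (dotV : {dot V for (@scalar_conj R k)})
  (a : {hermitian V for false & (@scalar_conj R k)})
  (W : nat -> completeNormedModType (scalar_field R k))
  (aW : forall i, {dot W i for (@scalar_conj R k)})
  (Rop : forall i, {linear W i -> V})
  (T : forall i, V -> W i)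
  (Lambda : R)
  (V_hilbert : induces_norm dotV)
  (V_separable : separable_space V)
  (a_continuous : continuous_form a)
  (a_coercive : coercive_form a)
  (W_hilbert : forall i, induces_norm (aW i))
  (Rop_bounded : forall i, bounded_operator (aW i) a (Rop i))
  (Rop_dense : dense (splitting_span Rop [set: nat]))
  (TE : forall i (v : V) (vi : W i), aW i (T i v) vi = a v (Rop i vi))
  (Rop_Lambda : forall i (vi : W i),
     form_norm a (Rop i vi) <= Lambda * form_norm (aW i) vi)
  (e : V) :
  let r i : W i := T i e in
  let rnorm i : R := form_norm (aW i) (r i) in
  let w i : V := if r i == 0 then 0
                 else scalar_of_real k (rnorm i)^-1 *: Rop i (r i) in
  (forall (istar : nat) (beta : R), 0 < beta -> beta <= 1 ->
     (beta%:E * ereal_sup (range (fun i => (rnorm i)%:E))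
        <= (rnorm istar)%:E)%E ->
     forall h : approx_space aW Rop (fun=> 1) 1%E, approx_nontrivial h ->
       scalar_of_real k (rnorm istar) = a e (w istar) /\
       rnorm istar >=
         beta / completed_norm h * scalar_re (a e (approx_val h)))
  /\
  (forall p : nat -> R, discrete_distribution p ->
     forall h : approx_space aW Rop p +oo%E, approx_nontrivial h ->
       let s := series (fun i => p i * rnorm i) in
       let s' := series (fun i => scalar_of_real k (p i) * a e (w i)) in
       [/\ cvgn s, cvgn s',
           scalar_of_real k (limn s) = limn s' &
           limn s >=
             (completed_norm h)^-1 * scalar_re (a e (approx_val h))]).
Proof.
(* The absolute value because [Lambda] is not assumed nonnegative. *)
move=> r rnorm w; pose B v := `|Lambda| * form_norm a v.
have rnorm_le v i : form_norm (aW i) (T i v) <= B v by exact: residual_norm_le.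
have a_w i : a e (w i) = scalar_of_real k (rnorm i) by exact: form_direction.
have embed (gamma : nat -> R) q :
    (forall u, approx_norm aW Rop gamma q u \is a fin_num ->
      scalar_re (a u u) <= B u * fine (approx_norm aW Rop gamma q u)) ->
    forall u, approx_norm aW Rop gamma q u \is a fin_num ->
      form_norm a u <= `|Lambda| * fine (approx_norm aW Rop gamma q u).
  move=> bound u uN; have := form_norm_ge0 a u.
  rewrite le_eqVlt => /predU1P[<-|u0].
    by rewrite mulr_ge0 ?fine_ge0 ?approx_norm_ge0.
  rewrite -(ler_pM2r u0) -expr2 sqr_form_norm; last exact: coercive_form_gt0.
  by rewrite mulrAC; exact: bound.
split=> [i beta beta0 _ rsup h _|p [p0 p1] h _ s s'].
- split; first by rewrite a_w.
  have rS j : rnorm j <= rnorm i / beta.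
    rewrite ler_pdivlMr// mulrC -lee_fin EFinM; apply: le_trans rsup.
    rewrite lee_wpmul2l ?lee_fin ?(ltW beta0)//.
    by apply: ereal_sup_ubound; exists j.
  have hle : scalar_re (a e (approx_val h)) <= rnorm i / beta * completed_norm h.
    apply: (@re_form_approx_val_le _ _ _ _ a aW Rop a_coercive a_continuous
      (fun=> 1) 1%E (lexx _) `|Lambda|) => //.
    + by apply: embed => u; apply: re_form_approx1_le.
    + exact: re_form_approx1_le.
  have := @completed_norm_ge0 _ _ _ _ aW Rop (fun=> 1) 1%E (lexx _) h.
  rewrite le_eqVlt => /predU1P[<-|h0].
    by rewrite invr0 mulr0 mul0r form_norm_ge0.
  rewrite mulrAC ler_pdivrMr// mulrC -ler_pdivlMr//.
  by rewrite mulrAC.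
- have p_le1 n : series p n <= 1.
    rewrite -(cvg_lim _ p1)//; apply: nondecreasing_cvgn_le.
      by apply: nondecreasing_series.
    by apply/cvg_ex; exists 1.
  have s_mono : nondecreasing_seq s.
    by apply: nondecreasing_series => i _ _; rewrite mulr_ge0 ?form_norm_ge0.
  have sum_le v n : \sum_(0 <= i < n) p i * form_norm (aW i) (T i v) <= B v.
    apply: (@le_trans _ _ (series p n * B v)).
      by rewrite /series /= mulr_suml; apply: ler_sum => i _; rewrite ler_wpM2l.
    by rewrite ler_piMl// mulr_ge0 ?form_norm_ge0.
  have s_cvg : cvgn s.
    apply: nondecreasing_is_cvgn => //; exists (B e) => _ [n _ <-].
    exact: sum_le.
  have s'E : s' = scalar_of_real k \o s.
    apply/funext => n; rewrite /s' /s /series /= raddf_sum.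
    by apply: eq_bigr => i _; rewrite a_w -rmorphM.
  have s'_cvg : s' @ \oo --> scalar_of_real k (limn s).
    by rewrite s'E; exact: cvg_scalar_of_real.
  split=> //.
  + by apply/cvg_ex; exists (scalar_of_real k (limn s)).
  + by apply/esym/cvg_lim.
  have hle : scalar_re (a e (approx_val h)) <= limn s * completed_norm h.
    apply: (@re_form_approx_val_le _ _ _ _ a aW Rop a_coercive a_continuous
      p +oo%E (leey _) `|Lambda|) => //.
    + by apply: embed => u; apply: re_form_approx_infty_le.
    + by apply: re_form_approx_infty_le => // n; exact: nondecreasing_cvgn_le.
  have := @completed_norm_ge0 _ _ _ _ aW Rop p +oo%E (leey _) h.
  rewrite le_eqVlt => /predU1P[<-|h0].
    rewrite invr0 mul0r; apply: (le_trans _ (nondecreasing_cvgn_le s_mono s_cvg 0%N)).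
    by rewrite /s /series /= big_geq.
  by rewrite mulrC ler_pdivrMr.
Qed.
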